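(* Suppose $m$ and $m'$ are both (positive) multiples of $4$. Then all non-trivial irreducible representations of $D_m\times D_{m'}$ are aspinorial, i.e. not spinorial.
   Context: Representations are finite-dimensional complex representations. $D_m=\langle r,s\mid r^m=1,\ s^2=1,\ rs=sr^{-1}\rangle$ is the dihedral group of order $2m$. All representations of $D_m$ are orthogonal (preserve a nondegenerate quadratic form), and every irreducible representation of $D_m\times D_{m'}$ is an external tensor product of irreducibles of the factors, hence orthogonal. For an orthogonal representation $\pi:G\to\mathrm{O}(V)$, $V$ a finite-dimensional complex space with nondegenerate quadratic form $Q$, let $C(V)$ be the Clifford algebra, the quotient of $T(V)$ by the two-sided ideal generated by $\{v\otimes v-Q(v):v\in V\}$. $\mathrm{Pin}^-(V)$ is the subgroup of $C(V)^\times$ generated by the $u\in V$ with $Q(u)=-1$; it is a double cover of $\mathrm{O}(V)$, the covering map sending each such $u$ to the reflection in the hyperplane orthogonal to $u$, with kernel $\{\pm1\}$. The representation $\pi$ is spinorial if there is a homomorphism $G\to\mathrm{Pin}^-(V)$ whose composition with the covering map is $\pi$. Known criterion: $\pi$ is spinorial iff $w_2(\pi)+w_1(\pi)^2=0$ in $H^2(G,\mathbb{Z}/2\mathbb{Z})$, where $w_i(\pi)$ are the Stiefel-Whitney classes of $\pi$ (pullbacks of the universal classes on $B\mathrm{O}(V)$). *)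

(* Defs.v *)
From HB Require Import structures.
From mathcomp Require Import all_boot all_order all_algebra.
From mathcomp Require Import all_fingroup all_solvable all_character.
From mathcomp Require Import generic_quotient ring_quotient.
From mathcomp Require Import boolp reals complex.
From mathcomp.multinomials Require Import monalg.

Set Implicit Arguments.
Unset Strict Implicit.
Unset Printing Implicit Defensive.

Import GRing.Theory.

Local Open Scope ring_scope.
Local Open Scope quotient_scope.

Inductive ideal_gen (A : nzRingType) (S : A -> Prop) : A -> Prop :=
| ideal_gen_in x of S x : ideal_gen S x
| ideal_gen0 : ideal_gen S 0
| ideal_genD x y of ideal_gen S x & ideal_gen S y : ideal_gen S (x + y)
| ideal_genMl a x of ideal_gen S x : ideal_gen S (a * x)
| ideal_genMr x a of ideal_gen S x : ideal_gen S (x * a).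

(* MathComp's [{ideal_quot _}] is a ring only over a commutative base and for a
   proper ideal; here the ideal is two-sided and may be the whole ring, so that
   the quotient is a possibly zero [pzRingType]. *)
Section TwoSidedQuotient.
Variables (A : nzRingType) (S : A -> Prop).

Definition ideal_pred : pred A := fun x => `[< ideal_gen S x >].

Fact ideal_pred_zmod_closed : zmod_closed ideal_pred.
Proof.
split=> [|x y /asboolP Ix /asboolP Iy]; apply/asboolP; first exact: ideal_gen0.
by rewrite -mulN1r; apply: ideal_genD => //; apply: ideal_genMl.
Qed.

HB.instance Definition _ :=
  GRing.isZmodClosed.Build A ideal_pred ideal_pred_zmod_closed.

Definition quot_by : Type := @Quotient.quot A (GRing.ZmodClosed.clone A ideal_pred _).

HB.instance Definition _ := GRing.Zmodule.on quot_by.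
HB.instance Definition _ := EqQuotient.on quot_by.

Definition to_quot (x : A) : quot_by := \pi_quot_by x.

Fact to_quotE x y : (to_quot x = to_quot y) <-> ideal_gen S (x - y).
Proof.
rewrite /to_quot; split=> [/eqP|Ixy]; last apply/eqP.
  by rewrite -Quotient.idealrBE => /asboolP.
by rewrite -Quotient.idealrBE; apply/asboolP.
Qed.

Fact to_quot_surj (q : quot_by) : to_quot (repr q) = q.
Proof. exact: reprK. Qed.

Definition quot_one : quot_by := to_quot 1.
Definition quot_mul (p q : quot_by) : quot_by := to_quot (repr p * repr q).

Fact to_quotM x y : to_quot (x * y) = quot_mul (to_quot x) (to_quot y).
Proof.
apply/to_quotE.
have Ix : ideal_gen S (x - repr (to_quot x)).
  by apply/to_quotE; rewrite to_quot_surj.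
have Iy : ideal_gen S (y - repr (to_quot y)).
  by apply/to_quotE; rewrite to_quot_surj.
rewrite -[x * y](subrK (repr (to_quot x) * y)) -mulrBl -addrA -mulrBr.
by apply: ideal_genD; [apply: ideal_genMr | apply: ideal_genMl].
Qed.

Fact to_quotD x y : to_quot (x + y) = to_quot x + to_quot y.
Proof. exact: Quotient.pi_add. Qed.

Fact quot_mulA : associative quot_mul.
Proof.
move=> p q r; rewrite -(to_quot_surj p) -(to_quot_surj q) -(to_quot_surj r).
by rewrite -!to_quotM mulrA.
Qed.

Fact quot_mul1 : left_id quot_one quot_mul.
Proof. by move=> p; rewrite -(to_quot_surj p) -to_quotM mul1r. Qed.

Fact quot_mulr1 : right_id quot_one quot_mul.
Proof. by move=> p; rewrite -(to_quot_surj p) -to_quotM mulr1. Qed.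

Fact quot_mulDl : left_distributive quot_mul +%R.
Proof.
move=> p q r; rewrite -(to_quot_surj p) -(to_quot_surj q) -(to_quot_surj r).
by rewrite -to_quotD -!to_quotM mulrDl to_quotD.
Qed.

Fact quot_mulDr : right_distributive quot_mul +%R.
Proof.
move=> p q r; rewrite -(to_quot_surj p) -(to_quot_surj q) -(to_quot_surj r).
by rewrite -to_quotD -!to_quotM mulrDr to_quotD.
Qed.

HB.instance Definition _ := GRing.Zmodule_isPzRing.Build quot_by
  quot_mulA quot_mul1 quot_mulr1 quot_mulDl quot_mulDr.

Fact to_quot_zmod_morphism : zmod_morphism to_quot.
Proof. by move=> x y; apply/eqP; rewrite eq_sym subr_eq -to_quotD subrK. Qed.

Fact to_quot_monoid_morphism : monoid_morphism to_quot.
Proof. by split=> // x y; rewrite to_quotM. Qed.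

HB.instance Definition _ :=
  GRing.isZmodMorphism.Build A quot_by to_quot to_quot_zmod_morphism.
HB.instance Definition _ :=
  GRing.isMonoidMorphism.Build A quot_by to_quot to_quot_monoid_morphism.

End TwoSidedQuotient.

Section QuadraticSpace.
Variables (F : fieldType) (n : nat).
Implicit Types (Q : 'rV[F]_n -> F) (u v w : 'rV[F]_n).

Definition polar Q u v : F := Q (u + v) - Q u - Q v.

Definition quadratic_form Q : Prop :=
  [/\ forall a v, Q (a *: v) = a ^+ 2 * Q v,
      forall a u v w, polar Q (a *: u + v) w = a * polar Q u w + polar Q v w
    & forall a u v w, polar Q w (a *: u + v) = a * polar Q w u + polar Q w v].

Definition nondegenerate Q : Prop :=
  forall u, (forall v, polar Q u v = 0) -> u = 0.

(* As everywhere in [mxrepresentation], a linear map of 'rV_n is the matrix that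
   acts by right multiplication, and composition is the product of matrices. *)
Definition reflection Q u : 'M[F]_n :=
  lin1_mx (fun v => v - (polar Q v u / Q u) *: u).

Fact mul_reflection Q u v :
  quadratic_form Q -> v *m reflection Q u = v - (polar Q v u / Q u) *: u.
Proof.
case=> _ Ql _; rewrite /reflection.
pose f w := w - (polar Q w u / Q u) *: u.
have f_lin : linear f.
  move=> a x y; rewrite /f Ql mulrDl scalerDl opprD addrACA scalerBr.
  by rewrite scalerA mulrA.
pose fL : {linear 'rV[F]_n -> 'rV[F]_n} :=
  HB.pack f (GRing.isLinear.Build _ _ _ _ f f_lin).
exact: (mul_rV_lin1 fL v).
Qed.

(* T(F^n) is the free associative algebra on the standard basis, i.e. the monoid
   algebra of the words in 'I_n; the word i_1 ... i_k is e_i1 (x) ... (x) e_ik. *)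
Definition tensor_alg : nzRingType := {malg F[{fmonom 'I_n}]}.

Definition tensor_vec v : tensor_alg :=
  \sum_(i < n) mkmalgU (fmu i) (v 0 i).

Definition tensor_scal (a : F) : tensor_alg := mkmalgU mone a.

Definition clifford_rel Q (t : tensor_alg) : Prop :=
  exists v, t = tensor_vec v * tensor_vec v - tensor_scal (Q v).

Definition clifford Q : pzRingType := quot_by (clifford_rel Q).

Definition clifford_vec Q v : clifford Q :=
  to_quot (clifford_rel Q) (tensor_vec v).

Fact clifford_vec_sqr Q v :
  clifford_vec Q v * clifford_vec Q v
    = to_quot (clifford_rel Q) (tensor_scal (Q v)).
Proof.
rewrite /clifford_vec -rmorphM; apply/to_quotE.
by apply: ideal_gen_in; exists v.
Qed.

Inductive pin_minus Q : clifford Q -> Prop :=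
| pin_minus_gen u of Q u = -1 : pin_minus (clifford_vec Q u)
| pin_minus1 : pin_minus 1
| pin_minusM x y of pin_minus x & pin_minus y : pin_minus (x * y)
| pin_minusV x y of pin_minus x & x * y = 1 & y * x = 1 : pin_minus y.

(* [pin_cover x g] says that the covering map sends x in Pin^- to g in O(V): the
   graph of this homomorphism is the subgroup of C(V)^* x GL(V) generated by the
   pairs formed of a generator u and the reflection it is sent to. *)
Inductive pin_cover Q : clifford Q -> 'M[F]_n -> Prop :=
| pin_cover_gen u of Q u = -1 : pin_cover (clifford_vec Q u) (reflection Q u)
| pin_cover1 : pin_cover 1 1%:M
| pin_coverM x y g h of pin_cover x g & pin_cover y h :
    pin_cover (x * y) (g *m h)
| pin_coverV x y g of pin_cover x g & x * y = 1 & y * x = 1 :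
    pin_cover y (invmx g).

Fact pin_minusP Q (x : clifford Q) :
  pin_minus x <-> exists g, pin_cover x g.
Proof.
split=> [|[g]]; last first.
  elim=> [u Qu||? ? ? ? _ ? _ ?|? y ? _ Px xy yx]; first exact: pin_minus_gen.
  - exact: pin_minus1.
  - exact: pin_minusM.
  - exact: pin_minusV Px xy yx.
elim=> [u Qu||y z _ [g yg] _ [h zh]|y z _ [g yg] yz zy].
- by exists (reflection Q u); apply: pin_cover_gen.
- by exists 1%:M; apply: pin_cover1.
- by exists (g *m h); apply: pin_coverM.
- by exists (invmx g); apply: pin_coverV yg yz zy.
Qed.

End QuadraticSpace.

Section Spinorial.
Variables (F : fieldType) (gT : finGroupType) (G : {group gT}) (n : nat).
Variables (Q : 'rV[F]_n -> F) (rG : mx_representation F G n).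

Definition orthogonal_repr : Prop :=
  [/\ quadratic_form Q, nondegenerate Q
    & forall g v, g \in G -> Q (v *m rG g) = Q v].

Definition spinorial : Prop :=
  exists phi : gT -> clifford Q,
    [/\ forall g, g \in G -> pin_minus (phi g),
        {in G &, forall g h, phi (g * h)%g = phi g * phi h}
      & forall g, g \in G -> pin_cover (phi g) (rG g)].

End Spinorial.

(* Main.v *)
(** An involution [t] of [G] whose [-1]-eigenspace has dimension [k] is a product of
    [k] reflections in pairwise orthogonal vectors [w_i] with [Q w_i = -1], so it lifts
    to [w_1 ... w_k], whose square is [(-1)^(k(k+1)/2)]. Since the kernel of the cover is
    [{1, -1}], every lift of [t] has this square, and a representation admitting such a
    [t] with [k = 1] or [k = 2] is not spinorial.

    A non-trivial irreducible representation of [D_m * D_m'] always has such a [t]. By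
    Schur's lemma [r + r^-1] acts by a scalar [c]. If [c <> 2, -2], then [r - r^-1] is
    invertible and anticommutes with [s], so [k = n / 2] for [t = s], and [n <= 4] as the
    translates by [1, s, s', s s'] of a common eigenvector of [r] and [r'] span. If both
    [r] and [r'] are [1] or [-1], the image is commutative, so [n = 1], and one of [s],
    [s r], [s'], [s' r'] acts by [-1].

    The kernel is controlled in a matrix model: symmetric pairwise anticommuting
    [g_0, ..., g_n] with [g_i ^ 2 = 1], where [g_0, ..., g_(n-1)] represent the Clifford
    algebra, transposition plays the spinor norm and [g_n] detects parity. *)

Require Import Defs.
From HB Require Import structures.
From mathcomp Require Import all_boot all_order all_algebra.
From mathcomp Require Import all_fingroup all_solvable all_character.
From mathcomp Require Import boolp reals complex.
From mathcomp.multinomials Require Import monalg.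
From mathcomp Require Import ring.

Set Implicit Arguments.
Unset Strict Implicit.
Unset Printing Implicit Defensive.

Import GRing.Theory Num.Theory.

Local Open Scope ring_scope.
Local Open Scope complex_scope.

(** * Torsion matrices and anticommuting involutions *)

Lemma unipotent_torsion_eq1 (F : numFieldType) (n m : nat) (N : 'M[F]_n.+1) :
  (0 < m)%N -> N * N = 0 -> (1 + N) ^+ m = 1 -> N = 0.
Proof.
move=> m_gt0 N2; have -> : (1 + N) ^+ m = 1 + N *+ m.
  elim: m {m_gt0} => [|m IHm]; first by rewrite mulr0n addr0 expr0.
  rewrite exprS IHm mulrDl mul1r mulrDr mulr1 mulrnAr N2 mul0rn addr0.
  by rewrite mulrSr addrA addrAC.
move/eqP; rewrite -subr_eq0 addrC addKr -scaler_nat scaler_eq0.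
by rewrite pnatr_eq0 eqn0Ngt m_gt0 => /eqP.
Qed.

(** With [e = c / 2] a sign, [A + A^-1 = 2 e] gives [(e A - 1)^2 = 0], so [e A] is unipotent of
    finite order, hence [1] in characteristic zero. *)
Lemma torsion_trace2_scalar (F : numFieldType) (n m : nat)
    (A A' : 'M[F]_n.+1) (c : F) :
  (0 < m)%N -> A * A' = 1 -> A ^+ m = 1 -> A + A' = c%:M -> c ^+ 2 = 4 ->
  exists2 e : F, e ^+ 2 = 1 & A = e%:M.
Proof.
move=> m_gt0 AA' Am sumA c4; pose e := c / 2.
have c2e : c = e *+ 2 by rewrite -mulr_natr /e divfK ?pnatr_eq0.
have e2 : e ^+ 2 = 1.
  apply: (@mulfI _ 4); first by rewrite pnatr_eq0.
  by rewrite mulr1 -[RHS]c4 c2e; ring.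
exists e => //; pose N := e *: A - 1.
have NN : N * N = 0.
  have A2 : A * A = c *: A - 1.
    apply/eqP; rewrite -[1]AA' eq_sym subr_eq -mulrDr sumA.
    by rewrite -mulmxE mul_mx_scalar.
  have XX : (e *: A) * (e *: A) = e *: A + (e *: A - 1).
    rewrite -scalerAl -scalerAr scalerA -expr2 e2 scale1r A2 c2e.
    by rewrite mulr2n scalerDl addrA.
  by rewrite /N mulrBr mulr1 mulrBl mul1r XX [_ + (_ - 1)]addrC addrK subrr.
have N0 : N = 0.
  (* Doubling the exponent makes the power of the sign [e] trivial too. *)
  apply: (@unipotent_torsion_eq1 _ _ (m * 2)) => //.
    by rewrite muln_gt0 m_gt0.
  rewrite [1 + _]addrC subrK exprZn [A ^+ _]exprM Am expr1n mulnC exprM e2 expr1n.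
  by rewrite scale1r.
move/eqP: N0; rewrite subr_eq0 => /eqP eA.
by rewrite -[A]scale1r -e2 expr2 -scalerA eA scalemx1.
Qed.

(** [D] exchanges the eigenspaces of [S] for [1] and [-1], so both have dimension [n / 2]; the
    second one is the image of [S - 1]. *)
Lemma rank_involution_anticomm (F : numFieldType) (n : nat) (D S : 'M[F]_n) :
  D \in unitmx -> S *m S = 1%:M -> D *m S = - (S *m D) ->
  (\rank (S - 1%:M)).*2 = n.
Proof.
move=> uD SS DS.
have eq_rank : \rank (S - 1%:M) = \rank (S + 1%:M)%R.
  have <- : \rank ((S - 1%:M) *m D) = \rank (S - 1%:M).
    by apply: mxrankMfree; rewrite row_free_unit.
  have <- : \rank (D *m (S + 1%:M)%R) = \rank (S + 1%:M)%R.
    by rewrite eqmxMfull ?row_full_unit.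
  by rewrite -mxrank_opp mulmxBl mulmxDr mul1mx mulmx1 DS opprB addrC.
apply/eqP; rewrite eqn_leq -addnn {2}eq_rank; apply/andP; split.
  apply: mulmx0_rank_max.
  by rewrite mulmxBl mul1mx mulmxDr SS mulmx1 [1%:M + S]addrC subrr.
rewrite {2}eq_rank -(mxrank_opp (S - 1%:M)).
apply: leq_trans (mxrank_add _ _); rewrite opprB addrA subrK.
by rewrite -mulr2n -scaler_nat mxrank_scale_nz ?pnatr_eq0 // mxrank1.
Qed.

Lemma dihedral_conj (gT : finGroupType) (x y : gT) :
  (x ^ y = x^-1 -> y * x = x^-1 * y)%g.
Proof. by move=> xy; rewrite [RHS]conjgC conjVg xy invgK. Qed.

Lemma rank_adds_row (F : fieldType) (m n k : nat) (A : 'M[F]_(m, n)) (v : 'rV_n) :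
  (\rank A <= k)%N -> (\rank (A + v)%MS <= k.+1)%N.
Proof.
move=> rkA; apply: leq_trans (mxrank_adds_leqif _ _) _.
by rewrite -(addn1 k) leq_add // rank_leq_row.
Qed.

(** * One dihedral relation with [r + r^-1] scalar *)

Section DihedralRelation.
Variables (F : numFieldType) (gT : finGroupType) (G : {group gT}).
Variables (n : nat) (rG : mx_representation F G n) (r s : gT) (c : F).
Hypotheses (Gr : r \in G) (Gs : s \in G).
Hypothesis rs : (r ^ s = r^-1)%g.
Hypothesis trace_r : rG r + rG r^-1%g = c%:M.

Lemma dihedral_reflection_rank :
  (s ^+ 2 = 1)%g -> c ^+ 2 != 4 -> (\rank (rG s - 1%:M)).*2 = n.
Proof.
move=> s2 c4; pose A := rG r; pose A' := rG r^-1%g.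
have AA' : A *m A' = 1%:M by rewrite -repr_mxM ?groupV // mulgV repr_mx1.
have A'A : A' *m A = 1%:M by rewrite -repr_mxM ?groupV // mulVg repr_mx1.
(* The square of [r - r^-1] is [(r + r^-1)^2 - 4], which makes it invertible when [c^2 <> 4];
   conjugation by [s] negates it. *)
have DD : (A - A') *m (A - A') = (c ^+ 2 - 4)%:M.
  have -> : (c ^+ 2 - 4)%:M = (A + A') *m (A + A') - (1%:M *+ 4) :> 'M[F]_n.
    rewrite trace_r -scalar_mxM -expr2 -[1%:M *+ 4]scaler_nat scalemx1.
    by rewrite -raddfB.
  rewrite !mulmxDl !mulmxDr !mulNmx !mulmxN AA' A'A opprK.
  rewrite [- 1%:M + _]addrC addrACA -opprD [1%:M + _ *m _]addrC [RHS]addrC.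
  by rewrite [_ + (_ + 1%:M)]addrACA -mulr2n addrCA (mulrnDr _ 2 2) [in RHS]opprD subrK.
have uD : A - A' \in unitmx.
  have nz : c ^+ 2 - 4 != 0 by rewrite subr_eq0.
  suff /mulmx1_unit[] : (A - A') *m ((c ^+ 2 - 4)^-1 *: (A - A')) = 1%:M by [].
  by rewrite -scalemxAr DD scale_scalar_mx mulVf.
apply: (rank_involution_anticomm uD).
  by rewrite -repr_mxM // [(s * s)%g]s2 repr_mx1.
rewrite mulmxBl mulmxBr opprB -!repr_mxM ?groupV //.
congr (rG _ - rG _); last by rewrite (dihedral_conj rs).
by rewrite conjgC rs.
Qed.

Lemma dihedral_rotation_scalar m :
  (0 < m)%N -> (r ^+ m = 1)%g -> c ^+ 2 = 4 ->
  exists2 e : F, e ^+ 2 = 1 & rG r = e%:M.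
Proof.
case: n rG trace_r => [|k] rho tr m_gt0 rm c4.
  (* In degree zero all matrices coincide; the matrix ring used below needs positive degree. *)
  by exists 1; [rewrite expr1n | rewrite [LHS]flatmx0 [RHS]flatmx0].
apply: (torsion_trace2_scalar m_gt0 _ _ tr c4).
  by rewrite -mulmxE -repr_mxM ?groupV // mulgV repr_mx1.
by rewrite -repr_mxX // rm repr_mx1.
Qed.

End DihedralRelation.

(** * Irreducible representations of two commuting dihedral pairs *)

Section DihedralPair.
Variables (F : numClosedFieldType) (gT : finGroupType) (G : {group gT}).
Variables (n : nat) (rG : mx_representation F G n).
Variables (r s r' s' : gT).
Hypothesis defG : G = <<[set r; s; r'; s']>>%g :> {set gT}.
Hypotheses (s2 : (s ^+ 2 = 1)%g) (s'2 : (s' ^+ 2 = 1)%g).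
Hypotheses (rs : (r ^ s = r^-1)%g) (r's' : (r' ^ s' = r'^-1)%g).
Hypotheses (rr' : commute r r') (rs' : commute r s').
Hypotheses (sr' : commute s r') (ss' : commute s s').
Hypothesis irrG : mx_irreducible rG.

Let gens : [/\ r \in G, s \in G, r' \in G & s' \in G].
Proof. by rewrite defG; split; apply: mem_gen; rewrite !inE eqxx ?orbT. Qed.

Lemma gens_central_scalar (A : 'M[F]_n) :
  r \in rcent rG A -> s \in rcent rG A -> r' \in rcent rG A ->
  s' \in rcent rG A -> exists a : F, A = a%:M.
Proof.
move=> Ar As Ar' As'; apply/is_scalar_mxP.
apply: (mx_abs_irr_cent_scalar (group_closure_closed_field irrG)).
by rewrite /centgmx defG gen_subG !subUset !sub1set Ar As Ar' As'.
Qed.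

(** The commuting [r] and [r'] share an eigenvector [v]. The span of [v], [v s], [v s'], [v s s'] is
    stable, hence the whole space. *)
Lemma dihedral_pair_degree : (0 < n <= 4)%N.
Proof.
have [Gr Gs Gr' Gs'] := gens; have [_ nz1 simpleG] := irrG.
have n_gt0 : (0 < n)%N.
  by rewrite lt0n; apply: contraNneq nz1 => n0; rewrite -mxrank_eq0 mxrank1 n0.
rewrite n_gt0 /=.
have comm_rr' : rG r *m rG r' = rG r' *m rG r by rewrite -!repr_mxM ?rr'.
have [v nz_v /andP[vr vr']] := common_eigenvector2 n_gt0 comm_rr'.
have {}vr : r \in rstabs rG v by rewrite inE Gr.
have {}vr' : r' \in rstabs rG v by rewrite inE Gr'.
pose U := (v + v *m rG s + v *m rG s' + v *m rG (s * s')%g)%MS.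
have [Uv Us Us' Uss'] : [/\ (v *m rG 1%g <= U)%MS, (v *m rG s <= U)%MS,
    (v *m rG s' <= U)%MS & (v *m rG (s * s')%g <= U)%MS].
  rewrite repr_mx1 mulmx1 /U addsmxSr; split=> //.
  - by do 3!apply: (submx_trans _ (addsmxSl _ _)).
  - by do 2!apply: (submx_trans _ (addsmxSl _ _)); apply: addsmxSr.
  - by apply: (submx_trans _ (addsmxSl _ _)); apply: addsmxSr.
(* The action is on the right, so an [h] preserving the line of [v] and written in front acts first
   and only rescales [v]. *)
have inU h y : h \in rstabs rG v -> y \in G -> (v *m rG y <= U)%MS ->
    (v *m rG (h * y)%g <= U)%MS.
  rewrite inE => /andP[Gh vh] Gy; apply: submx_trans.
  by rewrite repr_mxM // mulmxA submxMr.
have sss : (s * s = 1)%g by rewrite -s2.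
have s's's : (s' * s' = 1)%g by rewrite -s'2.
have stabU g : g \in G -> (v *m rG g <= U)%MS ->
    (v *m rG (s * g)%g <= U)%MS -> (v *m rG (s' * g)%g <= U)%MS ->
    (v *m rG (s * s' * g)%g <= U)%MS -> g \in rstabs rG U.
  move=> Gg U1 U2 U3 U4; rewrite inE Gg /= !(addsmxMr, addsmx_sub).
  by rewrite -!mulmxA -!repr_mxM ?groupM ?U1 ?U2 ?U3.
have modU : mxmodule rG U.
  rewrite /mxmodule [in X in X \subset _]defG gen_subG !subUset !sub1set.
  apply/andP; split; [apply/andP; split; [apply/andP; split|]|].
  (* Rotations are moved to the front, possibly inverted on the way; [s] and [s'] permute the four
     spanning vectors. *)
  - apply: stabU => //.
    + by rewrite -[r]mulg1; apply: inU.
    + by rewrite (dihedral_conj rs); apply: inU; rewrite ?groupV.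
    + by rewrite -rs'; apply: inU.
    + rewrite -mulgA -rs' mulgA (dihedral_conj rs) -mulgA.
      by apply: inU; rewrite ?groupV ?groupM.
  - apply: stabU => //; first by rewrite sss.
      by rewrite -ss'.
    by rewrite -mulgA -ss' mulgA sss mul1g.
  - apply: stabU => //.
    + by rewrite -[r']mulg1; apply: inU.
    + by rewrite sr'; apply: inU.
    + by rewrite (dihedral_conj r's'); apply: inU; rewrite ?groupV.
    + rewrite -mulgA (dihedral_conj r's') mulgA (commuteV sr') -mulgA.
      by apply: inU; rewrite ?groupV ?groupM.
  - apply: stabU => //; first by rewrite s's's.
    by rewrite -mulgA s's's mulg1.
have nzU : U != 0.
  apply: contraNneq nz_v => U0; rewrite -submx0 -U0.
  by move: Uv; rewrite repr_mx1 mulmx1.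
have /mxrankS := simpleG U modU (submx1 _) nzU; rewrite mxrank1 => /leq_trans-> //.
by do 3!apply: rank_adds_row; apply: rank_leq_row.
Qed.

(** All four generators then commute pairwise, so Schur's lemma makes each of them scalar; every
    element thus commutes with them and is scalar too. *)
Lemma dihedral_pair_commuting :
  rG r *m rG s = rG s *m rG r -> rG r' *m rG s' = rG s' *m rG r' ->
  forall g, g \in G -> exists a : F, rG g = a%:M.
Proof.
have [Gr Gs Gr' Gs'] := gens => com_rs com_r's'.
have centP x y : x \in G -> rG x *m rG y = rG y *m rG x -> x \in rcent rG (rG y).
  by move=> Gx xy; rewrite inE Gx xy eqxx.
have [com_rr' com_rs' com_sr' com_ss'] : [/\ rG r *m rG r' = rG r' *m rG r,
    rG r *m rG s' = rG s' *m rG r, rG s *m rG r' = rG r' *m rG s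
  & rG s *m rG s' = rG s' *m rG s].
  by rewrite -!repr_mxM // rr' rs' sr' ss'.
have [a ra] : exists a : F, rG r = a%:M.
  by apply: gens_central_scalar; apply: centP; rewrite ?com_rr' ?com_rs'.
have [b sb] : exists a : F, rG s = a%:M.
  by apply: gens_central_scalar; apply: centP; rewrite ?com_sr' ?com_ss'.
have [c rc] : exists a : F, rG r' = a%:M.
  by apply: gens_central_scalar; apply: centP; rewrite ?com_rr' ?com_rs'.
have [d sd] : exists a : F, rG s' = a%:M.
  by apply: gens_central_scalar; apply: centP; rewrite ?com_sr' ?com_ss'.
move=> g Gg; apply: gens_central_scalar; apply: centP => //.
- by rewrite ra scalar_mxC.
- by rewrite sb scalar_mxC.
- by rewrite rc scalar_mxC.
- by rewrite sd scalar_mxC.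
Qed.

Lemma dihedral_pair_involution m m' :
    (0 < m)%N -> (0 < m')%N -> (r ^+ m = 1)%g -> (r' ^+ m' = 1)%g ->
    rker rG != G ->
  exists t, [/\ t \in G, (t ^+ 2 = 1)%g & (0 < \rank (rG t - 1%:M)%R <= 2)%N].
Proof.
move=> m_gt0 m'_gt0 rm r'm' nkG; have [Gr Gs Gr' Gs'] := gens.
have /andP[n_gt0 n_le4] := dihedral_pair_degree.
(* When the [-1]-eigenspace is half of the space, [n <= 4] bounds its dimension by [2]. *)
have half k : k.*2 = n -> (0 < k <= 2)%N.
  by move=> def_n; rewrite -double_gt0 -[(k <= 2)%N]leq_double def_n n_gt0.
have inC x y : x \in G -> y \in G -> commute x y ->
    x \in rcent rG (rG y + rG y^-1%g).
  move=> Gx Gy xy; rewrite inE Gx mulmxDl mulmxDr -!repr_mxM ?groupV //.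
  by rewrite xy (commuteV xy) eqxx.
(* Conjugation by [y] swaps [x] and [x^-1], which preserves their sum. *)
have inCs x y : x \in G -> y \in G -> (x ^ y = x^-1)%g ->
    y \in rcent rG (rG x + rG x^-1%g).
  move=> Gx Gy xy; rewrite inE Gy mulmxDl mulmxDr -!repr_mxM ?groupV //.
  by rewrite (dihedral_conj xy) [(x * y)%g]conjgC xy addrC eqxx.
have [c trr] : exists c : F, rG r + rG r^-1%g = c%:M.
  by apply: gens_central_scalar; [|exact: inCs|..]; apply: inC.
have [c' trr'] : exists c : F, rG r' + rG r'^-1%g = c%:M.
  by apply: gens_central_scalar; [..|exact: inCs]; apply: inC.
have [c4|c4] := eqVneq (c ^+ 2) 4; last first.
  by exists s; rewrite Gs s2 half // (dihedral_reflection_rank _ _ rs trr).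
have [c'4|c'4] := eqVneq (c' ^+ 2) 4; last first.
  by exists s'; rewrite Gs' s'2 half // (dihedral_reflection_rank _ _ r's' trr').
have [e _ re] := dihedral_rotation_scalar Gr trr m_gt0 rm c4.
have [e' _ re'] := dihedral_rotation_scalar Gr' trr' m'_gt0 r'm' c'4.
have scal : forall g, g \in G -> exists a : F, rG g = a%:M.
  by apply: dihedral_pair_commuting; rewrite ?re ?re' scalar_mxC.
(* Scalar images commute, so the kernel contains all commutators; for an irreducible representation
   over a closed field this means degree one. *)
have n1 : n = 1.
  apply/eqP; rewrite -(der1_sub_rker (@group_closure_closed_field _ _ _) irrG).
  rewrite gen_subG; apply/subsetP=> _ /imset2P[x y Gx Gy ->].
  apply/rkerP; split; first by rewrite groupR.
  have [a xa] := scal x Gx; have [b yb] := scal y Gy.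
  have xy : rG (x * y)%g = rG (y * x)%g.
    by rewrite !repr_mxM // xa scalar_mxC.
  rewrite -(mulKg (y * x)%g [~ x, y]%g) -commgC repr_mxM ?groupV ?groupM // xy.
  by rewrite -repr_mxM ?groupV ?groupM // mulVg repr_mx1.
have small t : t \in G -> (t ^+ 2 = 1)%g -> rG t != 1%:M ->
    exists t, [/\ t \in G, (t ^+ 2 = 1)%g & (0 < \rank (rG t - 1%:M)%R <= 2)%N].
  move=> Gt t2 nt; exists t; split=> //; rewrite lt0n mxrank_eq0 subr_eq0 nt.
  by rewrite (leq_trans (rank_leq_row _)) // n1.
have invol (x y : gT) : (x ^ y = x^-1 -> y ^+ 2 = 1 -> (y * x) ^+ 2 = 1)%g.
  move=> xy y2; rewrite expgS expg1 {1}(dihedral_conj xy) -mulgA (mulgA y).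
  by rewrite [(y * y)%g]y2 mul1g mulVg.
(* If [s], [s'], [s r] and [s' r'] all act trivially, then so does every generator, against
   [nkG]. *)
have [s1|ns] := eqVneq (rG s) 1%:M; last exact: small ns.
have [s'1|ns'] := eqVneq (rG s') 1%:M; last exact: small ns'.
have [r1|] := eqVneq (rG r) 1%:M; last first.
  move=> nr; apply: (small (s * r)%g); rewrite ?groupM ?invol //.
  by rewrite repr_mxM // s1 mul1mx.
have [r'1|] := eqVneq (rG r') 1%:M; last first.
  move=> nr; apply: (small (s' * r')%g); rewrite ?groupM ?invol //.
  by rewrite repr_mxM // s'1 mul1mx.
case/negP: nkG; rewrite eqEsubset; apply/andP; split.
  by apply/subsetP=> x /rkerP[].
rewrite {1}defG gen_subG !subUset !sub1set.
by do !(apply/andP; split); apply/rkerP.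
Qed.

End DihedralPair.

(** * Generators of the product of two dihedral groups *)

Lemma dihedral_gens m : (1 < m)%N ->
  exists r s : 'D_(m.*2), [/\ [set: 'D_(m.*2)]%g = <<[set r; s]>>%g,
    (r ^+ m = 1)%g, (s ^+ 2 = 1)%g & (r ^ s = r^-1)%g].
Proof.
move=> m_gt1; have /existsP[[r s] /=] := isoGrp_hom (Grp_dihedral m_gt1).
rewrite !xpair_eqE => /and4P[/eqP defD /eqP rm /eqP s2 /eqP rs].
by exists r, s; rewrite -defD joing_idl joing_idr.
Qed.

Lemma setX_gens (gT hT : finGroupType) (A : {set gT}) (B : {set hT}) :
  [set: gT] = <<A>>%g -> [set: hT] = <<B>>%g ->
  [set: gT * hT] =
    <<[set (a, 1%g) | a in A] :|: [set (1%g, b) | b in B]>>%g.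
Proof.
move=> defA defB; apply/eqP; rewrite eqEsubset subsetT andbT.
apply/subsetP=> -[a b] _.
set H := <<_>>%g.
have -> : (a, b) = ((a, 1) * (1, b))%g by rewrite -[RHS]/(_, _) mulg1 mul1g.
have sA : (pairg1 hT @* <<A>> \subset H)%g.
  rewrite morphim_gen ?subsetT // genS // morphimEsub ?subsetT //.
  exact: subsetUl.
have sB : (@pair1g gT hT @* <<B>> \subset H)%g.
  rewrite morphim_gen ?subsetT // genS // morphimEsub ?subsetT //.
  exact: subsetUr.
apply: groupM.
  apply: (subsetP sA); rewrite -defA -[(a, 1%g)]/(pairg1 hT a).
  by apply: mem_morphim; rewrite inE.
apply: (subsetP sB); rewrite -defB -[(1%g, b)]/(@pair1g gT hT b).
by apply: mem_morphim; rewrite inE.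
Qed.

Lemma dihedral_prod_involution (F : numClosedFieldType) (m m' n : nat)
    (rG : mx_representation F [set: 'D_(m.*2) * 'D_(m'.*2)] n) :
  (1 < m)%N -> (1 < m')%N -> mx_irreducible rG ->
  rker rG != [set: 'D_(m.*2) * 'D_(m'.*2)]%g ->
  exists t, (t ^+ 2 = 1)%g /\ (0 < \rank (rG t - 1%:M)%R <= 2)%N.
Proof.
move=> m_gt1 m'_gt1 irrG nkG.
have [r [s [genD rm s2 rs]]] := dihedral_gens m_gt1.
have [r' [s' [genD' r'm' s'2 r's']]] := dihedral_gens m'_gt1.
have defG := setX_gens genD genD'; rewrite !imsetU1 !imset_set1 setUA in defG.
have pairX (gT hT : finGroupType) (x : gT) (y : hT) k :
    ((x, y) ^+ k = (x ^+ k, y ^+ k))%g.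
  by elim: k => // k IHk; rewrite !expgS IHk.
have conjX (gT hT : finGroupType) (x u : gT) (y v : hT) :
  ((x, y) ^ (u, v) = (x ^ u, y ^ v))%g by [].
have commX (x : 'D_(m.*2)) (y : 'D_(m'.*2)) : commute (x, 1%g) (1%g, y).
  by rewrite /commute -[LHS]/(_, _) -[RHS]/(_, _) !mulg1 !mul1g.
suff [t [_ t2 rk_t]] : exists t, [/\ t \in [set: 'D_(m.*2) * 'D_(m'.*2)]%g,
    (t ^+ 2 = 1)%g & (0 < \rank (rG t - 1%:M)%R <= 2)%N] by exists t.
apply: (dihedral_pair_involution defG _ _ _ _ _ _ _ _ _ _ (m := m) (m' := m')) => //;
  rewrite ?pairX ?conjX ?expg1n ?conj1g ?rm ?r'm' ?s2 ?s'2 ?rs ?r's' //.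
- by rewrite -[RHS]/(_, _) invg1.
- by rewrite -[RHS]/(_, _) invg1.
- exact: ltnW.
- exact: ltnW.
Qed.

(** * Orthonormal bases and orthogonal involutions *)

Section Quadratic.
Variables (F : numClosedFieldType) (n : nat) (Q : 'rV[F]_n -> F).
Hypothesis Q_quad : quadratic_form Q.
Implicit Types u v w x : 'rV[F]_n.

Lemma polarC u v : polar Q u v = polar Q v u.
Proof. by rewrite /polar [u + v]addrC addrAC. Qed.

Lemma quadD u v : Q (u + v) = Q u + Q v + polar Q u v.
Proof. by rewrite /polar; ring. Qed.

Lemma polarDl u v w : polar Q (u + v) w = polar Q u w + polar Q v w.
Proof. by case: Q_quad => _ /(_ 1 u v w); rewrite scale1r mul1r. Qed.

Lemma polar0l w : polar Q 0 w = 0.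
Proof. by apply: (@addrI _ (polar Q 0 w)); rewrite -polarDl !addr0. Qed.

Lemma polarZl a u w : polar Q (a *: u) w = a * polar Q u w.
Proof. by case: Q_quad => _ /(_ a u 0 w); rewrite addr0 polar0l addr0. Qed.

Lemma polarNl u w : polar Q (- u) w = - polar Q u w.
Proof. by rewrite -scaleN1r polarZl mulN1r. Qed.

Lemma polarDr u v w : polar Q w (u + v) = polar Q w u + polar Q w v.
Proof. by rewrite ![polar Q w _]polarC polarDl. Qed.

Lemma polarZr a u w : polar Q w (a *: u) = a * polar Q w u.
Proof. by rewrite ![polar Q w _]polarC polarZl. Qed.

Lemma quadZ a u : Q (a *: u) = a ^+ 2 * Q u.
Proof. by case: Q_quad. Qed.

Lemma polar_self u : polar Q u u = 2 * Q u.
Proof.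
by rewrite /polar -mulr2n -scaler_nat quadZ -addrA -opprD -mulr2n; ring.
Qed.

Lemma mul_reflectionN1 u v : Q u = -1 -> v *m reflection Q u = v + polar Q v u *: u.
Proof. by move=> Qu; rewrite mul_reflection // Qu invrN1 mulrN1 scaleNr opprK. Qed.

(** If [Q] vanished on [U], so would its polar form; otherwise a vector with [Q u <> 0] is rescaled
    by a square root of [-1 / Q u]. *)
Lemma nondegenerate_anisotropic (U : 'M_n) : U != 0 ->
    (forall u, (u <= U)%MS -> (forall v, (v <= U)%MS -> polar Q u v = 0) -> u = 0) ->
  exists2 x, (x <= U)%MS & Q x = -1.
Proof.
move=> nzU ndU; have [[u Uu nzQ]|isoU] := pselect (exists2 u, (u <= U)%MS & Q u != 0).
  exists (sqrtC (- (Q u)^-1) *: u); first exact: scalemx_sub.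
  by rewrite quadZ sqrtCK mulNr mulVf.
have Q0 u : (u <= U)%MS -> Q u = 0.
  by move=> Uu; apply/eqP/negP => nzQ; case: isoU; exists u => //; apply/negP.
case/negP: nzU; rewrite -nz_row_eq0; apply/eqP/ndU => [|v Uv].
  exact: nz_row_sub.
by rewrite /polar !Q0 ?addmx_sub ?nz_row_sub // !subr0.
Qed.

(** Induction on the rank: split off [x] with [Q x = -1] and pass to its orthogonal complement in
    [U]. Since [polar Q x x = 2 Q x = -2], the expansion carries the factor [-1/2]. *)
Lemma orthonormal_basis k (U : 'M_n) : \rank U = k ->
    (forall u, (u <= U)%MS -> (forall v, (v <= U)%MS -> polar Q u v = 0) -> u = 0) ->
  exists w : nat -> 'rV_n,
    [/\ forall i j, (i < k)%N -> (j < k)%N -> polar Q (w i) (w j) = - 2 *+ (i == j),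
        forall i, (i < k)%N -> (w i <= U)%MS
      & forall u, (u <= U)%MS ->
          u = - 2^-1 *: \sum_(i < k) polar Q u (w i) *: w i].
Proof.
have nz2 : 2 != 0 :> F by rewrite pnatr_eq0.
elim: k U => [|k IHk] U rkU ndU.
  exists (fun=> 0); split=> // u; move/eqP: rkU; rewrite mxrank_eq0 => /eqP->.
  by rewrite submx0 big_ord0 scaler0 => /eqP.
have nzU : U != 0 by rewrite -mxrank_eq0 rkU.
have [x Ux Qx] := nondegenerate_anisotropic nzU ndU.
have xx : polar Q x x = - 2 by rewrite polar_self Qx mulrN1.
(* [1 + reflection Q x] is twice the orthogonal projection [p] along [x], so [U'] is the complement
   of [x] in [U]. *)
pose U' := U *m (1%:M + reflection Q x).
have mulU' v : v *m (1%:M + reflection Q x) = v + v + polar Q v x *: x.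
  by rewrite mulmxDr mulmx1 mul_reflectionN1 // addrA.
pose p v := v + (polar Q v x / 2) *: x.
have polar_px v w : polar Q w x = 0 -> polar Q (p v) w = polar Q v w.
  by move=> wx; rewrite polarDl polarZl [polar Q x w]polarC wx mulr0 addr0.
have pU v : (v <= U)%MS -> (p v <= U')%MS.
  move=> Uv; have -> : p v = (2^-1 *: v) *m (1%:M + reflection Q x).
    rewrite -scalemxAl mulU' scalerDr scalerA -mulr2n -scaler_nat scalerA mulVf //.
    by rewrite scale1r mulrC.
  by rewrite submxMr // scalemx_sub.
have U'U v : (v <= U')%MS -> (v <= U)%MS.
  move=> /submx_trans; apply; apply/row_subP => i.
  by rewrite row_mul mulU' !addmx_sub ?row_sub // scalemx_sub.
have U'x v : (v <= U')%MS -> polar Q v x = 0.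
  case/submxP=> D ->; rewrite mulmxA mulU' !polarDl polarZl xx; ring.
have defp v : v = p v - (polar Q v x / 2) *: x by rewrite addrK.
have rkU' : \rank U' = k.
  have ltU : (\rank U' < \rank U)%N.
    suff: (U' < U)%MS by rewrite ltmxErank => /andP[].
    apply/andP; split; first by apply/rV_subP.
    apply: contra_eqN xx => UU'; rewrite U'x ?(submx_trans Ux) //.
    by rewrite eq_sym oppr_eq0.
  have leU : (\rank U <= (\rank U').+1)%N.
    apply: leq_trans (rank_adds_row x (leqnn (\rank U'))); apply: mxrankS.
    apply/rV_subP => v Uv; rewrite [v]defp addmx_sub //.
      exact: submx_trans (pU v Uv) (addsmxSl _ _).
    by rewrite -scaleNr scalemx_sub // addsmxSr.
  by apply/eqP; rewrite eqn_leq -ltnS -rkU ltU -ltnS -rkU.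
have ndU' u : (u <= U')%MS -> (forall v, (v <= U')%MS -> polar Q u v = 0) -> u = 0.
  move=> U'u u0; apply: ndU => [|v Uv]; first exact: U'U.
  by rewrite polarC -(polar_px v) ?U'x // polarC u0 // pU.
have [w [ww Uw defw]] := IHk U' rkU' ndU'.
exists (fun i => if i == k then x else w i); split=> [i j|i|u Uu].
- rewrite !ltnS [(i <= k)%N]leq_eqVlt [(j <= k)%N]leq_eqVlt.
  case: (eqVneq i k) => [->|ik] /= ltik; case: (eqVneq j k) => [->|jk] /= ltjk.
  + by [].
  + by rewrite polarC U'x ?Uw.
  + by rewrite ?(negPf ik) U'x ?Uw.
  + exact: ww.
- rewrite ltnS [(i <= k)%N]leq_eqVlt; case: eqVneq => //= _ ltik.
  exact/U'U/Uw.
rewrite big_ord_recr /= eqxx.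
under eq_bigr => i _ do rewrite ltn_eqF // -polar_px ?U'x ?Uw //.
by rewrite scalerDr -defw ?pU // {1}[u]defp scalerA mulNr scaleNr mulrC.
Qed.

End Quadratic.

(** The image of [g - 1] is the [-1]-eigenspace. For [u] in it,
    [polar Q u (v g - v) = -2 polar Q u v], so the form is nondegenerate there; expanding [v g - v]
    in an orthonormal basis of it gives the formula. *)
Lemma orthogonal_involution (F : numClosedFieldType) (n : nat)
    (Q : 'rV[F]_n -> F) (g : 'M_n) (k := \rank (g - 1%:M)) :
    quadratic_form Q -> Defs.nondegenerate Q ->
    (forall v, Q (v *m g) = Q v) -> g *m g = 1%:M ->
  exists w : nat -> 'rV_n,
    [/\ forall i j, (i < k)%N -> (j < k)%N -> polar Q (w i) (w j) = - 2 *+ (i == j)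
      & forall v, v *m g = v + \sum_(i < k) polar Q v (w i) *: w i].
Proof.
move=> Q_quad ndQ Qg gg.
have polar_g u v : polar Q (u *m g) (v *m g) = polar Q u v.
  by rewrite /polar -mulmxDl !Qg.
have Ug u : (u <= g - 1%:M)%MS -> u *m g = - u.
  case/submxP=> D ->; rewrite -mulmxA mulmxBl gg mul1mx -mulmxN opprB.
  by [].
have nz2 : 2 != 0 :> F by rewrite pnatr_eq0.
have [|w [ww Uw defw]] := orthonormal_basis Q_quad (erefl k).
  move=> u Uu u0; apply: ndQ => v.
  have := u0 (v *m (g - 1%:M)) (submxMl _ _).
  rewrite mulmxBr mulmx1 polarDr // [polar Q u (- v)]polarC polarNl //.
  rewrite -polar_g -[v *m g *m g]mulmxA gg mulmx1 Ug // polarNl //.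
  rewrite [polar Q v u]polarC => /eqP; rewrite -opprD oppr_eq0.
  by rewrite -mulr2n -mulr_natl mulf_eq0 (negPf nz2) => /eqP.
exists w; split=> // v.
have Uv : (v *m g - v <= g - 1%:M)%MS.
  by rewrite -[X in _ - X]mulmx1 -mulmxBr submxMl.
rewrite -[LHS](subrK v) addrC; congr (_ + _); rewrite {1}(defw _ Uv).
rewrite scaler_sumr; apply: eq_bigr => i _; rewrite scalerA; congr (_ *: _).
rewrite polarDl // polarNl // -(polar_g (v *m g)) -mulmxA gg mulmx1.
rewrite Ug ?Uw // [polar Q v (- _)]polarC polarNl // [polar Q (w i) v]polarC.
by field.
Qed.

(** * Anticommuting matrices and their words *)

(** Doubling: an old generator becomes the diagonal block matrix of [g i] and [- g i], and the new
    generator swaps the two blocks. *)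
Lemma symmetric_clifford_generators (F : fieldType) (k : nat) :
  exists (N : nat) (g : nat -> 'M[F]_N.+1),
    [/\ forall i, (i < k)%N -> (g i)^T = g i,
        forall i, (i < k)%N -> g i * g i = 1
      & forall i j, (i < k)%N -> (j < k)%N -> i != j -> g i * g j = - (g j * g i)].
Proof.
elim: k => [|k [N [g [gT g2 gC]]]]; first by exists 0%N, (fun=> 0).
pose g' i : 'M[F]_(N.+1 + N.+1) :=
  if i == k then block_mx 0 1%:M 1%:M 0 else block_mx (g i) 0 0 (- g i).
have g'k : g' k = block_mx 0 1%:M 1%:M 0 by rewrite /g' eqxx.
have g'lt i : (i < k)%N -> g' i = block_mx (g i) 0 0 (- g i).
  by move=> ltik; rewrite /g' ltn_eqF.
have g'gk i : (i < k)%N -> g' i *m g' k = - (g' k *m g' i).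
  move=> ltik; rewrite g'k g'lt // !mulmx_block opp_block_mx.
  by rewrite !(mulmx0, mul0mx, mulmx1, mul1mx, addr0, add0r, oppr0, opprK).
have ltS i : (i < k.+1)%N -> i = k \/ (i < k)%N.
  by rewrite ltnS leq_eqVlt => /predU1P.
have g'T i : (i < k.+1)%N -> (g' i)^T = g' i.
  case/ltS=> [->|ltik]; first by rewrite g'k tr_block_mx !trmx0 !trmx1.
  by rewrite g'lt // tr_block_mx !trmx0 linearN /= gT.
have g'2 i : (i < k.+1)%N -> g' i *m g' i = 1%:M.
  case/ltS=> [->|ltik].
    rewrite g'k mulmx_block !(mulmx0, mul0mx, mulmx1, addr0, add0r).
    by rewrite -scalar_mx_block.
  rewrite g'lt // mulmx_block !(mulmx0, mul0mx, addr0, add0r).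
  by rewrite mulmxN mulNmx opprK mulmxE g2 // -scalar_mx_block.
exists (N + N.+1)%N, g'; split=> // i j.
rewrite -mulmxE => /ltS[->|ltik] /ltS[->|ltjk]; rewrite ?eqxx // => ij.
- by have := g'gk j ltjk => ->; rewrite opprK.
- exact: g'gk.
have : g' i *m g' j = - (g' j *m g' i).
  rewrite !g'lt // !mulmx_block opp_block_mx !(mulmx0, mul0mx, addr0, add0r).
  by rewrite !(mulmxN, mulNmx) !opprK oppr0 mulmxE gC // opprK.
by [].
Qed.

Section Words.
Variables (F : numFieldType) (N k : nat) (g : nat -> 'M[F]_N.+1).
Hypothesis g_sym : forall i, (i < k.+1)%N -> (g i)^T = g i.
Hypothesis g_sqr : forall i, (i < k.+1)%N -> g i * g i = 1.
Hypothesis g_anticomm : forall i j,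
  (i < k.+1)%N -> (j < k.+1)%N -> i != j -> g i * g j = - (g j * g i).

Definition word (s : seq nat) : 'M[F]_N.+1 := \prod_(j <- s) g j.

Inductive word_span (P : seq nat -> Prop) : 'M[F]_N.+1 -> Prop :=
| word_span_word s of P s : word_span P (word s)
| word_span0 : word_span P 0
| word_spanD a x y of word_span P x & word_span P y : word_span P (a *: x + y).

(** The last generator [g k] is not a letter: it is reserved for detecting parity. *)
Definition letters (s : seq nat) : Prop := all (fun j => j < k)%N s.

(** A stage in the elimination of odd words, one letter at a time; at [i = k] every letter occurs
    evenly. *)
Definition even_below i s : Prop :=
  letters s /\ forall j, (j < i)%N -> ~~ odd (count_mem j s).

Lemma word_spanZ P a x : word_span P x -> word_span P (a *: x).
Proof. by move=> Px; rewrite -[_ *: _]addr0; apply/word_spanD/word_span0. Qed.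

Lemma word_span_add P x y : word_span P x -> word_span P y -> word_span P (x + y).
Proof. by rewrite -{2}[x]scale1r; apply: word_spanD. Qed.

Lemma word_spanM x y :
  word_span letters x -> word_span letters y -> word_span letters (x * y).
Proof.
move=> Sx Sy; elim: Sx => [s Ls||a u v _ Su _ Sv].
- elim: Sy => [t Lt||a u v _ Su _ Sv].
  + rewrite /word -big_cat; apply: word_span_word.
    by rewrite /letters all_cat Ls.
  + by rewrite mulr0; apply: word_span0.
  + by rewrite mulrDr -scalerAr; apply: word_spanD.
- by rewrite mul0r; apply: word_span0.
- by rewrite mulrDl -scalerAl; apply: word_spanD.
Qed.

Lemma trmx_word s : letters s -> (word s)^T = word (rev s).
Proof.
rewrite /letters /word; elim: s => [|j s IHs] /=.
  by rewrite !big_nil trmx1.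
case/andP=> ltjk Ls; rewrite big_cons rev_cons -cats1 big_cat big_seq1 -IHs //.
by rewrite -mulmxE trmx_mul g_sym // ltnW.
Qed.

Lemma word_span_tr x : word_span letters x -> word_span letters x^T.
Proof.
elim=> [s Ls||a u v _ Su _ Sv].
- rewrite trmx_word //; apply: word_span_word.
  by rewrite /letters all_rev.
- by rewrite trmx0; apply: word_span0.
- by rewrite linearP; apply: word_spanD.
Qed.

Let G := g k.
(** [G] anticommutes with every letter, so [D i] anticommutes with [g i] and commutes with the other
    letters. Conjugation by [D i] thus reads the parity of the occurrences of [i], whatever the
    length of the word. *)
Let D i := G * g i.

Let ltS i : (i < k)%N -> (i < k.+1)%N. Proof. exact: ltnW. Qed.
Let Gg i : (i < k)%N -> G * g i = - (g i * G).
Proof. by move=> ltik; rewrite g_anticomm ?(ltS ltik) // neq_ltn ltik orbT. Qed.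

Lemma twist_sqr i : (i < k)%N -> D i * D i = -1.
Proof.
move=> ltik; rewrite /D {1}Gg // mulNr mulrA -[g i * G * G]mulrA g_sqr //.
by rewrite mulr1 g_sqr // ltS.
Qed.

Lemma twist_gen i j : (i < k)%N -> (j < k)%N ->
  D i * g j = (-1) ^+ (j == i) *: (g j * D i).
Proof.
move=> ltik ltjk; rewrite /D; have [->|ji] := eqVneq j i.
  rewrite expr1 scaleN1r -mulrA g_sqr ?ltS // mulr1 Gg // mulrN opprK mulrA.
  by rewrite g_sqr ?ltS // mul1r.
rewrite expr0 scale1r -mulrA [g i * g j]g_anticomm ?ltS // 1?eq_sym //.
by rewrite mulrN !mulrA Gg // mulNr opprK.
Qed.

Lemma twist_word i s : (i < k)%N -> letters s ->
  D i * word s = (-1) ^+ (count_mem i s) *: (word s * D i).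
Proof.
rewrite /letters /word => ltik; elim: s => [|j s IHs] /=.
  by rewrite !big_nil mulr1 mul1r scale1r.
case/andP=> ltjk Ls; rewrite big_cons mulrA twist_gen // -scalerAl.
rewrite -[g j * D i * _]mulrA IHs //.
by rewrite -scalerAr scalerA -exprD mulrA.
Qed.

(* [z -> (z - D_i z D_i) / 2] projects onto the commutant of [D_i]; it fixes the
   words in which [i] occurs an even number of times and kills the others. *)
Lemma word_span_twist i z : (i < k)%N -> D i * z = z * D i ->
  word_span (even_below i) z -> word_span (even_below i.+1) z.
Proof.
move=> ltik Dz Sz; pose E x := 2^-1 *: (x - D i * x * D i).
have nz2 : 2 != 0 :> F by rewrite pnatr_eq0.
have half x : 2^-1 *: (x + x) = x :> 'M[F]_N.+1.
  by rewrite -mulr2n -scaler_nat scalerA mulVf // scale1r.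
suff: word_span (even_below i.+1) (E z).
  by rewrite /E Dz -mulrA twist_sqr // mulrN1 opprK half.
elim: Sz => [s [Ls evs]||a x y _ Sx _ Sy].
- rewrite /E twist_word // -scalerAl -mulrA twist_sqr // mulrN1 scalerN opprK.
  rewrite -signr_odd; have [odd_i|even_i] := boolP (odd (count_mem i s)).
    by rewrite expr1 scaleN1r subrr scaler0; apply: word_span0.
  rewrite expr0 scale1r half; apply: word_span_word; split=> // j.
  by rewrite ltnS leq_eqVlt => /predU1P[->|/evs].
- by rewrite /E mulr0 mul0r subr0 scaler0; apply: word_span0.
- have -> : E (a *: x + y) = a *: E x + E y.
    rewrite /E mulrDr mulrDl -scalerAr -scalerAl opprD addrACA -scalerBr.
    by rewrite scalerDr !scalerA mulrC.
  exact: word_spanD.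
Qed.

Lemma word_commute_gen j s : (j < k)%N -> letters s ->
  exists c : F, g j * word s = c *: (word s * g j).
Proof.
rewrite /letters /word => ltjk; elim: s => [|i s IHs] /=.
  by exists 1; rewrite !big_nil mulr1 mul1r scale1r.
case/andP=> ltik /IHs[c gs]; rewrite big_cons; have [<-|ji] := eqVneq j i.
  by exists c; rewrite -mulrA scalerAr -gs.
exists (- c); rewrite mulrA g_anticomm ?ltS // mulNr -[g i * g j * _]mulrA gs -scalerAr.
by rewrite scaleNr mulrA.
Qed.

(** The first letter occurs again; moved next to that occurrence, up to a scalar, it cancels with
    it, and all parities are kept. *)
Lemma even_word_scalar s : even_below k s -> exists c : F, word s = c%:M.
Proof.
have [m] := ubnP (size s); elim: m s => // m IHm [|j s] /= le_s [Ls evs].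
  by exists 1; rewrite /word big_nil.
have /andP[ltjk {}Ls] : (j < k)%N && all (fun i => i < k)%N s := Ls.
have js : j \in s.
  have := evs j ltjk; rewrite /= eqxx -has_pred1 has_count.
  by case: (count_mem j s).
case/splitPr: js le_s Ls evs => s1 s2; rewrite size_cat /= => le_s.
rewrite /letters all_cat /= => /and3P[L1 _ L2] evs.
have [c gs1] := word_commute_gen ltjk L1.
have [||d ds] := IHm (s1 ++ s2).
- by rewrite size_cat; move: le_s; rewrite addnS ltnS => /ltnW.
- split=> [|i ltik]; first by rewrite /letters all_cat L1.
  by have := evs i ltik; rewrite !count_cat /= !oddD !oddb;
    case: (j == i); case: (odd _); case: (odd _).
exists (c * d); rewrite -scale_scalar_mx -ds /word big_cons !big_cat big_cons /=.
rewrite mulrA -/(word s1) gs1 -scalerAl -mulrA [g j * (_ * _)]mulrA.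
by rewrite g_sqr ?ltS ?mul1r.
Qed.

(** Commuting with each [D i] in turn eliminates the words where [i] occurs an odd number of times;
    the words that remain are scalar. *)
Lemma twist_commutant_scalar z : word_span letters z ->
  (forall i, (i < k)%N -> D i * z = z * D i) -> exists c : F, z = c%:M.
Proof.
move=> Sz Dz; have: word_span (even_below k) z.
  suff span_i i : (i <= k)%N -> word_span (even_below i) z by apply: span_i.
  elim: i => [_|i IHi ltik].
    elim: Sz => [s Ls||a x y _ Sx _ Sy]; last exact: word_spanD.
      by apply: word_span_word; split.
    exact: word_span0.
  by apply: word_span_twist (Dz i ltik) _ => //; apply/IHi/ltnW.
elim=> [s /even_word_scalar //||a x y _ [c ->] _ [d ->]].
  by exists 0; rewrite raddf0.
by exists (a * c + d); rewrite scale_scalar_mx -raddfD.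
Qed.

End Words.

(** * Universal properties of the quotient and of the Clifford algebra *)

Lemma quot_by_lift (A : nzRingType) (S : A -> Prop) (B : nzRingType)
    (f : {rmorphism A -> B}) : (forall x, S x -> f x = 0) ->
  exists h : quot_by S -> B,
    [/\ h 1 = 1, {morph h : x y / x * y} & forall x, h (to_quot S x) = f x].
Proof.
move=> fS0; have f_ideal x : ideal_gen S x -> f x = 0.
  elim=> {x} [x Sx||x y _ fx _ fy|a x _ fx|x a _ fx].
  - exact: fS0.
  - by rewrite rmorph0.
  - by rewrite rmorphD fx fy addr0.
  - by rewrite rmorphM fx mulr0.
  - by rewrite rmorphM fx mul0r.
pose h (q : quot_by S) := f (generic_quotient.repr q).
have hE x : h (to_quot S x) = f x.
  apply/eqP; rewrite -subr_eq0 -rmorphB; apply/eqP/f_ideal/to_quotE.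
  exact: to_quot_surj.
exists h; split=> // [|x y]; first by rewrite -[1]/(to_quot S 1) hE rmorph1.
pose rep := @generic_quotient.repr A (quot_by S).
by rewrite -[x * y]/(to_quot S (rep x * rep y)) hE rmorphM.
Qed.

(** Words of the tensor algebra go to products of images of basis vectors, and the condition on
    squares kills the Clifford relations. *)
Lemma clifford_lift (F : fieldType) (n N : nat) (Q : 'rV[F]_n -> F)
    (f : 'rV[F]_n -> 'M[F]_N.+1) :
  linear f -> (forall v, f v * f v = (Q v)%:M) ->
  exists rho : clifford Q -> 'M[F]_N.+1,
    [/\ rho 1 = 1, {morph rho : x y / x * y} & forall v, rho (clifford_vec Q v) = f v].
Proof.
move=> f_lin f2; pose fL : {linear 'rV[F]_n -> 'M[F]_N.+1} :=
  HB.pack f (GRing.isLinear.Build _ _ _ _ f f_lin).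
pose h (m : {fmonom 'I_n}) := \prod_(i <- m) f (delta_mx 0 i).
have hM : mmorphism h.
  split=> [x y|]; first by rewrite /h fmM big_cat.
  by rewrite /h fm1 big_nil.
pose hL : {mmorphism {fmonom 'I_n} -> 'M[F]_N.+1} :=
  HB.pack h (isMultiplicative.Build _ _ h hM).
pose phi : tensor_alg F n -> 'M[F]_N.+1 := mmap (@scalar_mx F N.+1) hL.
have phiB : zmod_morphism phi by exact: (@mmapB _ _ _ (@scalar_mx F N.+1) hL).
have phiM : monoid_morphism phi.
  split; first exact: mmap1.
  (* Multiplicativity holds because the coefficients go to scalar matrices, which are central. *)
  have [] := @commr_mmap_is_multiplicative _ _ _ (@scalar_mx F N.+1) hL _ => // t m m'.
  by rewrite /GRing.comm -!mulmxE scalar_mxC.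
pose phiL : {rmorphism tensor_alg F n -> 'M[F]_N.+1} :=
  HB.pack phi (GRing.isZmodMorphism.Build _ _ phi phiB)
    (GRing.isMonoidMorphism.Build _ _ phi phiM).
have phi_scal a : phi (tensor_scal n a) = a%:M.
  by rewrite /phi /tensor_scal mmapU /= /h fm1 big_nil mulr1.
have phi_vec v : phi (tensor_vec v) = f v.
  rewrite /tensor_vec -[phi]/(phiL : _ -> _) rmorph_sum [v in RHS]row_sum_delta.
  rewrite -[f]/(fL : _ -> _) linear_sum; apply: eq_bigr => i _; rewrite linearZ /=.
  by rewrite /phi mmapU /= /h fmU big_seq1 -mulmxE mul_scalar_mx.
have [|rho [rho1 rhoM rhoE]] := @quot_by_lift _ (clifford_rel Q) _ phiL.
  by move=> _ [v ->]; rewrite rmorphB rmorphM /= phi_vec phi_scal f2 subrr.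
by exists rho; split=> // v; rewrite /clifford_vec rhoE /= phi_vec.
Qed.

(** * The matrix model of the Pin group *)

Section SpinModel.
Variables (F : numClosedFieldType) (n : nat) (Q : 'rV[F]_n -> F).
Hypothesis Q_quad : quadratic_form Q.
Variables (N : nat) (g : nat -> 'M[F]_N.+1) (w : nat -> 'rV[F]_n).
Hypothesis g_sym : forall i, (i < n.+1)%N -> (g i)^T = g i.
Hypothesis g_sqr : forall i, (i < n.+1)%N -> g i * g i = 1.
Hypothesis g_anticomm : forall i j,
  (i < n.+1)%N -> (j < n.+1)%N -> i != j -> g i * g j = - (g j * g i).
Hypothesis w_orth : forall i j, (i < n)%N -> (j < n)%N ->
  polar Q (w i) (w j) = - 2 *+ (i == j).
Hypothesis w_basis : forall u, u = - 2^-1 *: \sum_(i < n) polar Q u (w i) *: w i.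

Let nz2 : 2 != 0 :> F. Proof. by rewrite pnatr_eq0. Qed.
Let ltS i : (i < n)%N -> (i < n.+1)%N. Proof. exact: ltnW. Qed.

(* [Q (w i) = -1] while [g i] squares to [1], hence the factor ['i]. *)
Definition gamma (v : 'rV[F]_n) : 'M[F]_N.+1 :=
  \sum_(i < n) ('i / 2 * polar Q v (w i)) *: g i.

Lemma gamma_is_linear : linear gamma.
Proof.
move=> a u v; rewrite /gamma scaler_sumr -big_split; apply: eq_bigr => i _ /=.
by rewrite polarDl // polarZl // scalerA -scalerDl; congr (_ *: _); ring.
Qed.

Lemma gammaD u v : gamma (u + v) = gamma u + gamma v.
Proof. by have := gamma_is_linear 1 u v; rewrite !scale1r. Qed.

Lemma gammaZ a v : gamma (a *: v) = a *: gamma v.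
Proof.
have gamma0 : gamma 0 = 0 by apply: (@addrI _ (gamma 0)); rewrite -gammaD !addr0.
by have := gamma_is_linear a v 0; rewrite gamma0 !addr0.
Qed.

Lemma sum_generators_sqr (a : 'I_n -> F) :
  (\sum_i a i *: g i) * (\sum_i a i *: g i) = (\sum_i a i ^+ 2)%:M.
Proof.
pose M (i j : 'I_n) := (a i *: g i) * (a j *: g j).
set S := \sum_i _; have SS : S * S = \sum_i \sum_j M i j.
  by rewrite mulr_suml; apply: eq_bigr => i _; rewrite mulr_sumr.
have Mii i : M i i = (a i ^+ 2)%:M.
  by rewrite /M -scalerAl -scalerAr g_sqr ?ltS // scalerA -expr2 scalemx1.
have Mij i j : j != i -> M i j + M j i = 0.
  move=> ji; rewrite /M -!scalerAl -!scalerAr (g_anticomm _ _ ji) ?ltS ?ltn_ord //.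
  by rewrite !scalerA [a j * _]mulrC scalerN subrr.
(* Adding the double sum to itself with exchanged indices pairs [M p q] with [M q p], so that
   off-diagonal terms cancel. *)
have SS2 : S * S + S * S = \sum_p \sum_q (M p q + M q p).
  rewrite {1}SS SS [X in _ + X]exchange_big -big_split.
  by apply: eq_bigr => p _; rewrite -big_split.
have : S * S + S * S = (\sum_p a p ^+ 2)%:M + (\sum_p a p ^+ 2)%:M.
  rewrite SS2 -raddfD -big_split raddf_sum; apply: eq_bigr => p _ /=.
  rewrite (bigD1 p) //= big1 => [|q qp]; last exact: Mij.
  by rewrite addr0 Mii raddfD.
rewrite -!mulr2n -!scaler_nat => /(scalerI _); apply.
exact: nz2.
Qed.

Lemma polar_sumr v (I : finType) (c : I -> F) (u : I -> 'rV[F]_n) :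
  polar Q v (\sum_i c i *: u i) = \sum_i c i * polar Q v (u i).
Proof.
elim/big_ind2: _ => [|x x' y y' <- <-|i _].
- by rewrite polarC polar0l.
- by rewrite polarDr.
- by rewrite polarZr.
Qed.

(** Both sides are [-1/4] times the sum of the squares of the [polar Q v (w i)]. *)
Lemma gamma_sqr v : gamma v * gamma v = (Q v)%:M.
Proof.
rewrite sum_generators_sqr; congr _%:M; apply: (mulfI nz2).
rewrite -polar_self // [X in _ = polar _ _ X]w_basis polarZr // polar_sumr !mulr_sumr.
apply: eq_bigr => i _; rewrite exprMn exprMn sqrCi.
by field.
Qed.

Lemma gamma_polar u v : gamma u * gamma v + gamma v * gamma u = (polar Q u v)%:M.
Proof.
apply: (addrI (gamma u * gamma u + gamma v * gamma v)).
rewrite [RHS](_ : _ = gamma (u + v) * gamma (u + v)); last first.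
  by rewrite !gamma_sqr -!raddfD /= quadD.
rewrite gammaD mulrDl !mulrDr -!addrA; congr (_ + _).
by rewrite addrCA; congr (_ + _); rewrite addrC.
Qed.

Lemma gamma_tr v : (gamma v)^T = gamma v.
Proof.
rewrite /gamma raddf_sum; apply: eq_bigr => i _.
by rewrite /= linearZ /= g_sym ?ltS.
Qed.

Lemma gamma_span v : word_span g (letters n) (gamma v).
Proof.
rewrite /gamma; elim/big_ind: _ => [|x y|i _].
- exact: word_span0.
- exact: word_span_add.
apply: word_spanZ; have -> : g i = word g [:: i : nat] by rewrite /word big_seq1.
by apply: word_span_word; rewrite /letters /= ltn_ord.
Qed.

Lemma gamma_last v : g n * gamma v = - (gamma v * g n).
Proof.
rewrite /gamma mulr_sumr mulr_suml -sumrN; apply: eq_bigr => i _.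
have ni : n != i :> nat by rewrite neq_ltn ltn_ord orbT.
by rewrite -scalerAl -scalerAr (g_anticomm _ _ ni) ?(ltS (ltn_ord i)) ?scalerN.
Qed.

Lemma gamma_basis i : (i < n)%N -> gamma (w i) = - 'i *: g i.
Proof.
move=> ltin; rewrite /gamma (bigD1 (Ordinal ltin)) //= big1 => [|j ji].
  by rewrite w_orth // eqxx addr0 mulr1n; congr (_ *: _); field.
have -> : polar Q (w i) (w j) = 0.
  by rewrite w_orth // eq_sym -(inj_eq val_inj) /= in ji *; rewrite (negPf ji).
by rewrite mulr0 scale0r.
Qed.

(* The subgroup of pairs [(X, h)] satisfying this contains the pairs formed of a
   generator of Pin^- and its reflection; [e] is the determinant of [h]. *)
Definition twisted_pair (X : 'M[F]_N.+1) (h : 'M[F]_n) : Prop :=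
  [/\ h \in unitmx, word_span g (letters n) X
    & exists e : F, [/\ e ^+ 2 = 1, X^T * X = e%:M, g n * X = e *: (X * g n)
        & forall v, gamma v * X = e *: (X * gamma (v *m h))]].

(** Here [e = -1]; the polarized Clifford relation turns conjugation by [gamma u] into the
    reflection, up to this sign. *)
Lemma twisted_pair_gen u : Q u = -1 -> twisted_pair (gamma u) (reflection Q u).
Proof.
move=> Qu; have gu2 : gamma u * gamma u = -1 by rewrite gamma_sqr Qu raddfN.
split; [|exact: gamma_span|].
  suff /mulmx1_unit[] : reflection Q u *m reflection Q u = 1%:M by [].
  apply/row_matrixP => i; rewrite !rowE mulmxA mulmx1 !mul_reflectionN1 //.
  rewrite polarDl // polarZl // polar_self // Qu -addrA -scalerDl.
  by rewrite [X in X *: u](_ : _ = 0) ?scale0r ?addr0 //; ring.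
exists (-1); split; first by rewrite sqrrN expr1n.
- by rewrite gamma_tr gu2 raddfN.
- by rewrite gamma_last scaleN1r.
move=> v; rewrite mul_reflectionN1 // gammaD gammaZ mulrDr -scalerAr gu2.
by rewrite scaleN1r opprD scalerN opprK scalemx1 -gamma_polar addrC addrK.
Qed.

Lemma twisted_pair1 : twisted_pair 1 1%:M.
Proof.
split; first exact: unitmx1.
  have -> : 1 = word g [::] by rewrite /word big_nil.
  exact: word_span_word.
exists 1; split=> [|||v]; rewrite ?expr1n ?trmx1 ?mulr1 ?mul1r ?scale1r //.
by rewrite mulmx1.
Qed.

Lemma twisted_pairM X Y h k :
  twisted_pair X h -> twisted_pair Y k -> twisted_pair (X * Y) (h *m k).
Proof.
case=> uh SX [e [e2 XX gX cX]] [uk SY [d [d2 YY gY cY]]].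
split; [by rewrite unitmx_mul uh | exact: word_spanM|exists (e * d); split].
- by rewrite exprMn e2 d2 mulr1.
- rewrite -mulmxE trmx_mul mulmxE mulrA -[Y^T * _ * _]mulrA XX.
  by rewrite -mulmxE mul_mx_scalar -scalemxAl mulmxE YY scale_scalar_mx.
- by rewrite mulrA gX -scalerAl -[X * g n * Y]mulrA gY -scalerAr scalerA mulrA.
- move=> v; rewrite mulrA cX -scalerAl -[X * gamma _ * Y]mulrA cY -scalerAr scalerA.
  by rewrite mulrA mulmxA.
Qed.

(** The inverse must stay in the span of words: [X^T X = e] gives [X^-1 = e X^T], and transposition
    reverses words. *)
Lemma twisted_pairV X Y h :
  twisted_pair X h -> X * Y = 1 -> twisted_pair Y (invmx h).
Proof.
case=> uh SX [e [e2 XX gX cX]] XY.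
have YX : Y * X = 1 by rewrite -mulmxE; apply: mulmx1C.
have ee x : e *: (e *: x) = x :> 'M[F]_N.+1 by rewrite scalerA -expr2 e2 scale1r.
have XE : X^T = e *: Y.
  by rewrite -[X^T]mulr1 -XY mulrA XX -mulmxE mul_scalar_mx.
have YE : Y = e *: X^T by rewrite XE ee.
have key A B : X * A = e *: (B * X) -> A * Y = e *: (Y * B).
  move=> XA; rewrite -[A]mul1r -YX -[Y * X * A]mulrA XA -scalerAr -scalerAl.
  by rewrite -!mulrA XY mulr1.
split; first by rewrite unitmx_inv.
  by rewrite YE; apply/word_spanZ/word_span_tr.
exists e; split=> //.
- by rewrite {1}YE linearZ /= trmxK -scalerAl XY scalemx1.
- by apply: key; rewrite gX ee.
by move=> v; apply: key; rewrite cX ee mulmxKV.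
Qed.

(** [Z] commutes with [g n] and with each [g i] up to the same sign [e], hence commutes with the
    products [g n * g i] and is a scalar [c]. Transposition gives [c^2 = e], and [g n] forces
    [e = 1]. *)
Lemma twisted_pair1_scalar Z : twisted_pair Z 1%:M -> Z = 1 \/ Z = -1.
Proof.
case=> _ SZ [e [e2 ZZ gZ cZ]].
have commZ i : (i < n)%N -> g i * Z = e *: (Z * g i).
  move=> ltin; have := cZ (w i); rewrite mulmx1 gamma_basis //.
  rewrite -scalerAl -scalerAr scalerA mulrC -scalerA.
  by move/scalerI; apply; rewrite oppr_eq0 neq0Ci.
have [i ltin|c Zc] := twist_commutant_scalar g_sqr g_anticomm SZ.
  rewrite -mulrA commZ // -scalerAr [g n * (Z * _)]mulrA gZ -scalerAl scalerA.
  by rewrite -expr2 e2 scale1r mulrA.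
have scalarI (a b : F) : a%:M = b%:M :> 'M[F]_N.+1 -> a = b.
  by move/matrixP/(_ 0 0); rewrite !mxE eqxx.
have c2 : c ^+ 2 = e.
  by apply: scalarI; rewrite -ZZ Zc tr_scalar_mx -mulmxE -scalar_mxM.
have e0 : e != 0 by rewrite -sqrf_eq0 e2 oner_neq0.
have c0 : c != 0 by rewrite -sqrf_eq0 c2.
have e1 : e = 1.
  apply: (mulIf c0); rewrite mul1r; apply: scalarI.
  have := congr1 ( *%R^~ (g n)) gZ; rewrite Zc -!mulmxE mul_mx_scalar mul_scalar_mx.
  by rewrite scalerA -!scalemxAl mulmxE g_sqr // !scalemx1.
move/eqP: c2; rewrite e1 sqrf_eq1 Zc => /orP[]/eqP->; first by left.
by right; rewrite raddfN.
Qed.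

(** [X Y^-1] lies over the identity, so [X] is [Y] or [- Y]. *)
Lemma twisted_pair_sqr X Y h : twisted_pair X h -> twisted_pair Y h -> X * X = Y * Y.
Proof.
move=> Xh Yh; have [uh _ [e [e2 YY _ _]]] := Yh.
have VY : e *: Y^T * Y = 1.
  by rewrite -scalerAl YY scale_scalar_mx -expr2 e2.
have YV : Y * (e *: Y^T) = 1 by rewrite -mulmxE; apply: mulmx1C.
have := twisted_pairM Xh (twisted_pairV Yh YV); rewrite mulmxV //.
have defX : X = X * (e *: Y^T) * Y.
  by rewrite -mulrA VY mulr1.
by case/twisted_pair1_scalar => XY; rewrite defX XY ?mulN1r ?mulrNN ?mul1r.
Qed.

End SpinModel.

(** * Squares of lifts and the obstruction *)

Lemma spin_lift_sqr (F : numClosedFieldType) (n : nat) (Q : 'rV[F]_n -> F) :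
    quadratic_form Q -> Defs.nondegenerate Q ->
  exists (N : nat) (rho : clifford Q -> 'M[F]_N.+1),
    [/\ rho 1 = 1, {morph rho : x y / x * y},
        forall u, rho (clifford_vec Q u) * rho (clifford_vec Q u) = (Q u)%:M,
        forall u v, rho (clifford_vec Q u) * rho (clifford_vec Q v)
          + rho (clifford_vec Q v) * rho (clifford_vec Q u) = (polar Q u v)%:M
      & forall x y h, pin_cover x h -> pin_cover y h -> rho x * rho x = rho y * rho y].
Proof.
move=> Q_quad ndQ.
have [||w [w_orth _ w_basis]] := @orthonormal_basis _ _ Q Q_quad n 1%:M.
- exact: mxrank1.
- by move=> u _ u0; apply: ndQ => v; apply/u0/submx1.
have {}w_basis u := w_basis u (submx1 _).
(* There is one generator for each vector of an orthonormal basis, and one more for parity. *)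
have [N [g [g_sym g_sqr g_anticomm]]] := symmetric_clifford_generators F n.+1.
pose f := gamma Q g w.
have f2 : forall v, f v * f v = (Q v)%:M by exact: gamma_sqr.
have f_lin : linear f by exact: gamma_is_linear.
have [rho [rho1 rhoM rhoE]] := clifford_lift f_lin f2.
exists N, rho; split=> // [u|u v|]; rewrite ?rhoE //; first exact: gamma_polar.
have pin_twisted x h : pin_cover x h -> twisted_pair Q g w (rho x) h.
  elim=> {x h} [u Qu||x y h k _ xh _ yk|x y h _ xh xy _].
  - by rewrite rhoE; apply: twisted_pair_gen.
  - by rewrite rho1; apply: twisted_pair1.
  - by rewrite rhoM; apply: twisted_pairM.
  - by apply: twisted_pairV xh _ => //; rewrite -rhoM xy rho1.
move=> x y h /pin_twisted xh /pin_twisted yh.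
exact: twisted_pair_sqr xh yh.
Qed.

Lemma involution_not_spinorial (F : numClosedFieldType) (gT : finGroupType)
    (G : {group gT}) (n : nat) (rG : mx_representation F G n)
    (Q : 'rV[F]_n -> F) (t : gT) :
    orthogonal_repr Q rG -> t \in G -> (t ^+ 2 = 1)%g ->
    (0 < \rank (rG t - 1%:M)%R <= 2)%N ->
  ~ spinorial Q rG.
Proof.
case=> Q_quad ndQ Qg Gt t2 rk_t [phi [_ phiM phi_cover]].
have [N [rho [rho1 rhoM rho_sqr rho_polar lift_sqr]]] := spin_lift_sqr Q_quad ndQ.
have tt : rG t *m rG t = 1%:M by rewrite -repr_mxM // [(t * t)%g]t2 repr_mx1.
have Qt v : Q (v *m rG t) = Q v by apply: Qg.
have [w [w_orth w_mul]] := orthogonal_involution Q_quad ndQ Qt tt.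
set k := \rank _ in rk_t w_orth w_mul.
have Qw i : (i < k)%N -> Q (w i) = -1.
  move=> ltik; apply: (@mulfI _ 2); first by rewrite pnatr_eq0.
  by rewrite -polar_self // w_orth // eqxx mulr1n mulrN1.
(* The explicit lift is [w 0] or [w 0 * w 1]; the latter squares to [- (w 0)^2 (w 1)^2 = -1] by
   anticommutation. *)
have [y yt y2] : exists2 y, pin_cover y (rG t) & rho y * rho y = -1.
  case: k => [|[|[|k]]] // in rk_t w_orth w_mul Qw *.
    exists (clifford_vec Q (w 0%N)); last by rewrite rho_sqr Qw // raddfN.
    have -> : rG t = reflection Q (w 0%N); last exact/pin_cover_gen/Qw.
    apply/row_matrixP => i; rewrite !rowE w_mul mul_reflectionN1 ?Qw //.
    by rewrite big_ord1.
  exists (clifford_vec Q (w 0%N) * clifford_vec Q (w 1%N)).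
    have -> : rG t = reflection Q (w 0%N) *m reflection Q (w 1%N).
      apply/row_matrixP => i; rewrite !rowE mulmxA w_mul !mul_reflectionN1 ?Qw //.
      rewrite polarDl // polarZl // w_orth // mulr0n mulr0 addr0.
      by rewrite big_ord_recl big_ord1 addrA.
    by apply: pin_coverM; apply/pin_cover_gen/Qw.
  rewrite rhoM; set a := rho _; set b := rho _.
  have ab : a * b = - (b * a).
    by apply/eqP; rewrite -addr_eq0 rho_polar w_orth // mulr0n raddf0.
  rewrite {2}ab mulrN mulrA -[a * b * b]mulrA rho_sqr Qw // raddfN mulrN1.
  by rewrite mulNr opprK rho_sqr Qw // raddfN.
(* [phi 1] is idempotent, and its square has the same image as that of the trivial lift [1]. *)
have phi1 : rho (phi 1%g) = 1.
  have := lift_sqr _ _ _ (phi_cover 1%g (group1 G)).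
  rewrite repr_mx1 => /(_ 1 (pin_cover1 _)); rewrite rho1 mulr1 -rhoM.
  by rewrite -phiM // mulg1.
have := lift_sqr _ _ _ (phi_cover t Gt) yt.
rewrite y2 -rhoM -phiM // [(t * t)%g]t2 phi1 => /matrixP/(_ 0 0).
rewrite !mxE eqxx => /eqP; rewrite -subr_eq0 opprK.
by rewrite (_ : _ + _ = 2%:R) ?pnatr_eq0.
Qed.

Theorem corollary1p7 (R : realType) (m m' : nat)
    (m_gt0 : (0 < m)%N) (m'_gt0 : (0 < m')%N)
    (m_mul4 : (4 %| m)%N) (m'_mul4 : (4 %| m')%N)
    (n : nat)
    (rG : mx_representation R[i] [set: 'D_(m.*2) * 'D_(m'.*2)] n)
    (Q : 'rV[R[i]]_n -> R[i]) :
  mx_irreducible rG ->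
  rker rG != [set: 'D_(m.*2) * 'D_(m'.*2)]%g ->
  orthogonal_repr Q rG ->
  ~ spinorial Q rG.
Proof.
move=> irrG nkG orthG.
(* The dihedral presentation requires more than one rotation. *)
have gt1 k : (0 < k)%N -> (4 %| k)%N -> (1 < k)%N.
  by move=> k_gt0 /(dvdn_leq k_gt0); apply: leq_trans.
have [t [t2 rk_t]] :=
  dihedral_prod_involution (gt1 m m_gt0 m_mul4) (gt1 m' m'_gt0 m'_mul4) irrG nkG.
exact: (involution_not_spinorial orthG (in_setT t) t2 rk_t).
Qed.
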